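(* Let $n\ge 1$, let $X=X(t)$ be a smooth function of $t\in\mathbb{R}$ with values in the $n\times n$ matrices, and let $(m_0,m_1,m_2,\dots)$ be a sequence of integers such that, for some $M$, $m_i=0$ for every $i>M$. Then $$\frac{\mathrm{d}}{\mathrm{d}t}\,Z^{(m_0,m_1,m_2,\dots)}(X)=\sum_{i=1}^{\infty}(m_i+1)\,Z^{(m_0,\dots,m_{i-2},\,m_{i-1}-1,\,m_i+1,\,m_{i+1},\dots)}(X),$$ where in the $i$-th term the index $m_{i-1}$ is replaced by $m_{i-1}-1$, the index $m_i$ by $m_i+1$, and all other indices are unchanged (only finitely many terms of the sum are nonzero).
   Context: Matrices have entries in $\mathbb{R}$ or $\mathbb{C}$, and $I$ is the $n\times n$ identity matrix. For $n\times n$ matrices $X_1,\dots,X_k$, the generalized matrix invariants $Z_{m_1,\dots,m_k}(X_1,\dots,X_k)$ are the coefficients in the polynomial expansion, in the scalar commuting variables $\alpha_1,\dots,\alpha_k$, $$\det\Big(I+\sum_{i=1}^k\alpha_iX_i\Big)=\sum_{m_1,\dots,m_k}\alpha_1^{m_1}\cdots\alpha_k^{m_k}\,Z_{m_1,\dots,m_k}(X_1,\dots,X_k),$$ where the sum is taken over all $(m_1,\dots,m_k)\in\mathbb{Z}^k$, with $Z_{m_1,\dots,m_k}(X_1,\dots,X_k):=0$ whenever the monomial $\alpha_1^{m_1}\cdots\alpha_k^{m_k}$ does not appear in the expansion (in particular whenever some $m_i<0$). Trailing zero indices may be dropped together with the corresponding matrices: $Z_{m_1,\dots,m_{k-1},0}(X_1,\dots,X_k)=Z_{m_1,\dots,m_{k-1}}(X_1,\dots,X_{k-1})$.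 For a smooth matrix-valued function $X$ and an integer sequence $(m_0,m_1,m_2,\dots)$ with $m_i=0$ for all $i>M$, one defines $$Z^{(m_0,m_1,m_2,\dots)}(X):=Z_{m_0,m_1,m_2,\dots}(X,X',X'',\dots)=Z_{m_0,m_1,\dots,m_M}\big(X,X',\dots,X^{(M)}\big),$$ a scalar function of $t$, where $X^{(j)}$ denotes the $j$-th derivative of $X$ with respect to $t$. *)

(* Defs.v *)
From HB Require Import structures.
From mathcomp Require Import all_boot all_order all_algebra.
From mathcomp Require Import all_classical all_reals all_analysis.
From mathcomp.real_closed Require Export complex.
(* The notations of mpoly clash with those of mathcomp-analysis. *)
From mathcomp.multinomials Require Export (canonicals, coercions) mpoly.
Set Implicit Arguments.
Unset Strict Implicit.
Unset Printing Implicit Defensive.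
Import Order.TTheory GRing.Theory Num.Theory numFieldNormedType.Exports.
Local Open Scope classical_set_scope.
Local Open Scope ring_scope.

(* The complex numbers as a normed space over the reals, for the modulus norm
   that [Rcomplex R] already carries, so that [derivable], [is_derive] and
   [derive1n] apply to functions [R -> Rcomplex R] of a real variable. *)
Section RcomplexNormedModule.
Variable R : rcfType.

HB.instance Definition _ :=
  PseudoMetric.copy (Rcomplex R) (pseudoMetric_normed (Rcomplex R)).

HB.instance Definition _ := isPointed.Build (Rcomplex R) 0.

HB.instance Definition _ :=
  NormedZmod_PseudoMetric_eq.Build R (Rcomplex R) erefl.

Lemma Rcomplex_normrZ (l : R) (x : Rcomplex R) : `|l *: x| = `|l| * `|x|.
Proof.
case: x => a b; rewrite /Num.norm/= !exprMn -mulrDr.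
by rewrite sqrtrM ?sqr_ge0// sqrtr_sqr.
Qed.

HB.instance Definition _ :=
  PseudoMetricNormedZmod_Lmodule_isNormedModule.Build R (Rcomplex R)
    Rcomplex_normrZ.

End RcomplexNormedModule.

Section Invariants.
Variables (K : comNzRingType) (n : nat).

Definition det_pencil k (X : 'I_k -> 'M[K]_n) : mpoly.mpoly k K :=
  \det (1%:M + \sum_(i < k)
    mpoly.mpolyX K (mpoly.mnm1 i) *: map_mx (@mpoly.mpolyC k K) (X i)).

Definition multinom_abs k (m : 'I_k -> int) : mpoly.multinom k :=
  mpoly.Multinom [tuple `|m i|%N | i < k].

Definition Zinv k (m : 'I_k -> int) (X : 'I_k -> 'M[K]_n) : K :=
  if [forall i, 0 <= m i]
  then mpoly.mcoeff (multinom_abs m) (det_pencil X) else 0.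

(* Some M with m_i = 0 for all i > M (a junk value if there is none).  The
   choice is immaterial, as trailing zero indices may be dropped. *)
Definition index_bound (m : nat -> int) : nat :=
  xget 0%N [set M | forall i, (M < i)%N -> m i = 0].

Definition Zseq (m : nat -> int) (Y : nat -> 'M[K]_n) : K :=
  Zinv (fun i : 'I_(index_bound m).+1 => m i) (fun i => Y i).

End Invariants.

Section MatrixFunctions.
Variables (R : realType) (V : normedModType R) (n : nat).
Implicit Types X : R -> 'M[V]_n.

Definition mxderive1n (j : nat) X : R -> 'M[V]_n :=
  fun t => \matrix_(p, q) derive1n j (fun s => X s p q) t.

Definition mxsmooth X : Prop :=
  forall j p q t, derivable (derive1n j (fun s => X s p q)) t 1.

End MatrixFunctions.

(* A notation rather than a definition because the entries must carry both a
   ring structure and a normed space structure over the reals. *)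
Notation Zjet m X := (fun t => Zseq m (fun j => mxderive1n j X t)).

(* Only meaningful for i >= 1. *)
Definition shift_index (i : nat) (m : nat -> int) : nat -> int :=
  fun j => if j == i.-1 then m j - 1 else if j == i then m j + 1 else m j.

(* Main.v *)
(* For fixed t, let P = I + sum_i a_i X^(i), a matrix over the polynomials in
   the a_i.  Differentiating P in t replaces X^(i) by X^(i+1), and so does the
   derivation sum_i a_(i-1) d/da_i of the polynomial ring.  Both are
   derivations, so they act on det P in the same way, and comparing the
   coefficients of the monomial with exponents m gives the formula.  With the
   variables cut off at a_k, the two differ by the term a_k X^(k+1), which does
   not contribute to a monomial with m_k = 0. *)
From HB Require Import structures.
Require Import Defs.
From mathcomp Require Import all_boot all_order all_algebra.
From mathcomp Require Import perm zify.
From mathcomp Require Import all_classical all_reals all_analysis.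
Import Order.TTheory GRing.Theory Num.Theory numFieldNormedType.Exports.
Local Open Scope classical_set_scope.
Local Open Scope ring_scope.
Set Implicit Arguments.
Unset Strict Implicit.
Unset Printing Implicit Defensive.

(* [D f a] reads: a is the derivative of f at t.  A relation covers both the
   analytic derivative (T the real line) and an algebraic derivation of A
   (T a single point).  Only 1 is required to be a constant: for T a point
   every element of A is a constant function. *)
Definition derivation_at (A : comNzRingType) (T : Type) (t : T)
    (D : (T -> A) -> A -> Prop) : Prop :=
  [/\ D (fun=> 1) 0,
      forall f g f' g', D f f' -> D g g' -> D (fun s => f s - g s) (f' - g')
    & forall f g f' g', D f f' -> D g g' ->
        D (fun s => f s * g s) (f' * g t + f t * g')].

(** * Calculus rules for an abstract derivation *)

Section DerivationAt.
Variables (A : comNzRingType) (T : Type) (t : T) (D : (T -> A) -> A -> Prop).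
Hypothesis derD : derivation_at t D.

Lemma derivation_at0 : D (fun=> 0) 0.
Proof.
have [D1 DB _] := derD; have := DB _ _ _ _ D1 D1.
by rewrite !subrr.
Qed.

Lemma derivation_atN f f' : D f f' -> D (fun s => - f s) (- f').
Proof.
have [_ DB _] := derD; move=> /(DB _ _ _ _ derivation_at0).
by rewrite sub0r; under eq_fun do rewrite sub0r.
Qed.

Lemma derivation_atD f g f' g' :
  D f f' -> D g g' -> D (fun s => f s + g s) (f' + g').
Proof.
have [_ DB _] := derD; move=> Df /derivation_atN /(DB _ _ _ _ Df).
by rewrite opprK; under eq_fun do rewrite opprK.
Qed.

Lemma derivation_at_sum (I : Type) (r : seq I) (P : pred I) (f : I -> T -> A)
    (f' : I -> A) : (forall i, P i -> D (f i) (f' i)) ->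
  D (fun s => \sum_(i <- r | P i) f i s) (\sum_(i <- r | P i) f' i).
Proof.
move=> Df; elim: r => [|a r IH].
  by rewrite big_nil; under eq_fun do rewrite big_nil; exact: derivation_at0.
rewrite big_cons; under eq_fun do rewrite big_cons.
by case: ifP => // Pa; apply: derivation_atD => //; exact: Df.
Qed.

Lemma derivation_at_nat (n : nat) : D (fun=> n%:R) 0.
Proof.
have [D1 _ _] := derD; elim: n => [|n IH]; first exact: derivation_at0.
by rewrite -[0]addr0; under eq_fun do rewrite -addn1 natrD; exact: derivation_atD.
Qed.

Lemma derivation_at_sign (n : nat) : D (fun=> (-1) ^+ n) 0.
Proof.
under eq_fun do rewrite -signr_odd; case: (odd n).
  by rewrite -oppr0; exact: derivation_atN (derivation_at_nat 1).
exact: derivation_at_nat 1.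
Qed.

Lemma derivation_atMl (c : A) (f : T -> A) f' :
  D (fun=> c) 0 -> D f f' -> D (fun s => c * f s) (c * f').
Proof.
have [_ _ DM] := derD.
by move=> Dc /(DM _ _ _ _ Dc); rewrite mul0r add0r.
Qed.

(** The omitted factor is singled out by the value of its index, hence [uniq r]. *)
Lemma derivation_at_prod (I : eqType) (r : seq I) (f : I -> T -> A)
    (f' : I -> A) : uniq r -> (forall i, D (f i) (f' i)) ->
  D (fun s => \prod_(i <- r) f i s)
    (\sum_(i <- r) f' i * \prod_(j <- r | j != i) f j t).
Proof.
have [D1 _ DM] := derD; move=> + Df; elim: r => [_|a r IH /= /andP[ar ur]].
  by rewrite big_nil; under eq_fun do rewrite big_nil; exact: D1.
rewrite big_cons; under eq_fun do rewrite big_cons.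
(* Peeling off the factor of [a] brings the sum into the shape of the two-factor product rule. *)
have -> : f' a * \prod_(j <- a :: r | j != a) f j t +
    \sum_(i <- r) f' i * \prod_(j <- a :: r | j != i) f j t =
    f' a * (\prod_(j <- r) f j t) +
    f a t * \sum_(i <- r) f' i * \prod_(j <- r | j != i) f j t.
  congr (_ * _ + _).
    rewrite big_cons eqxx big_seq_cond [RHS]big_seq; apply: eq_bigl => j.
    by case: eqP => [->|_]; rewrite ?(negbTE ar) ?andbT.
  rewrite big_distrr/= big_seq [RHS]big_seq; apply: eq_bigr => i ir.
  rewrite big_cons; case: eqP => [ai|_]; last by rewrite mulrCA.
  by rewrite ai ir in ar.
exact: DM (Df a) (IH ur).
Qed.

End DerivationAt.

(** * The differential of the determinant, read off the Leibniz expansion *)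

Definition det_deriv (A : comNzRingType) n (M M' : 'M[A]_n) : A :=
  \sum_(s : {perm 'I_n}) (-1) ^+ s *
    \sum_i M' i (s i) * \prod_(j | j != i) M j (s j).

Lemma det_derivD (A : comNzRingType) n (M M1 M2 : 'M[A]_n) :
  det_deriv M (M1 + M2) = det_deriv M M1 + det_deriv M M2.
Proof.
rewrite -big_split; apply: eq_bigr => s _ /=; rewrite -mulrDr -big_split.
by congr (_ * _); apply: eq_bigr => i _; rewrite mxE mulrDl.
Qed.

Lemma det_derivZ (A : comNzRingType) n (M M1 : 'M[A]_n) (c : A) :
  det_deriv M (c *: M1) = c * det_deriv M M1.
Proof.
rewrite /det_deriv big_distrr; apply: eq_bigr => s _ /=.
rewrite mulrCA; congr (_ * _); rewrite big_distrr.
by apply: eq_bigr => i _ /=; rewrite mxE mulrA.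
Qed.

(** The Leibniz expansion is a sum of signed products, and signs are constants for any derivation.
    The result involves [D] only through [M'], so derivations with the same values on the entries
    agree on the determinant. *)
Lemma derivation_at_det (A : comNzRingType) (T : Type) (t : T)
    (D : (T -> A) -> A -> Prop) n (M : T -> 'M[A]_n) (M' : 'M[A]_n) :
    derivation_at t D -> (forall p q, D (fun s => M s p q) (M' p q)) ->
  D (fun s => \det (M s)) (det_deriv (M t) M').
Proof.
move=> derD DM; apply: (derivation_at_sum derD) => s _.
apply: (derivation_atMl derD); first exact: derivation_at_sign derD _.
apply: (derivation_at_prod derD (f := fun i u => M u i (s i))) => //.
exact: index_enum_uniq.
Qed.

(** * Derivations of the polynomial ring *)

Section MPolyDerivations.
Variables (K : comNzRingType) (k : nat).

(** The extension of [D] to polynomials under which the variables are constants. *)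
Definition coeffwise (T : Type) (D : (T -> K) -> K -> Prop)
    (f : T -> mpoly.mpoly k K) (f' : mpoly.mpoly k K) : Prop :=
  forall m, D (fun s => mpoly.mcoeff m (f s)) (mpoly.mcoeff m f').

Lemma coeffwise_derivation (T : Type) (t : T) (D : (T -> K) -> K -> Prop) :
  derivation_at t D -> derivation_at t (coeffwise D).
Proof.
move=> derD; have [_ DB DM] := derD; split.
- move=> m; rewrite mpoly.mcoeff0; under eq_fun do rewrite mpoly.mcoeff1.
  exact: derivation_at_nat derD _.
- move=> f g f' g' Df Dg m; rewrite mpoly.mcoeffB.
  by under eq_fun do rewrite mpoly.mcoeffB; exact: DB.
- move=> f g f' g' Df Dg m; rewrite mpoly.mcoeffD !mpoly.mcoeffM -big_split/=.
  under eq_fun do rewrite mpoly.mcoeffM.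
  by apply: (derivation_at_sum derD) => i _; exact: DM.
Qed.

(** Subtraction of exponents truncates at 0, so monomials free of the variable [i] form a separate
    case. In the final formula they give the terms whose lowered index is -1. *)
Lemma mcoeffXM (i : 'I_k) (p : mpoly.mpoly k K) (m : mpoly.multinom k) :
  mpoly.mcoeff m (mpoly.mpolyX K (mpoly.mnm1 i) * p) =
  if m i == 0%N then 0 else mpoly.mcoeff (mpoly.mnm_sub m (mpoly.mnm1 i)) p.
Proof.
case: eqP => [mi0|/eqP mi0].
  rewrite mpoly.mcoeffM big1// => -[k1 k2] /= /eqP mE.
  rewrite mpoly.mcoeffX; case: eqP => [k1E|_]; last by rewrite mul0r.
  have := congr1 (fun u : mpoly.multinom k => u i) mE.
  by rewrite /= mi0 mpoly.mnmDE -k1E mpoly.mnm1E eqxx.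
rewrite mulrC -[in LHS](@mpoly.submK _ (mpoly.mnm1 i) m).
  by rewrite mpoly.addmC mpoly.mcoeffMX.
apply/mpoly.mnm_lepP => j; rewrite mpoly.mnm1E.
by case: eqP => // <-; rewrite lt0n.
Qed.

End MPolyDerivations.

(* The derivation sum_i a_(i-1) d/da_i of the header. *)
Definition lowering (K : comNzRingType) k (p : mpoly.mpoly k.+1 K) :=
  \sum_(i < k) mpoly.mpolyX K (mpoly.mnm1 (widen_ord (leqnSn k) i)) *
    mpoly.mderiv (lift ord0 i) p.

Lemma lowering_derivation (K : comNzRingType) k :
  derivation_at tt (fun f f' => f' = @lowering K k (f tt)).
Proof.
rewrite /lowering; split => /=.
- rewrite big1// => i _.
  by rewrite -mpoly.mpolyC1 mpoly.mderivC mulr0.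
- move=> f g _ _ -> ->; rewrite -sumrB; apply: eq_bigr => i _.
  by rewrite mpoly.mderivB mulrBr.
- move=> f g _ _ -> ->; rewrite mulr_suml mulr_sumr -big_split.
  by apply: eq_bigr => i _ /=; rewrite mpoly.mderivM mulrDr !mulrA [_ * f tt]mulrC.
Qed.

(** * Substitution of 0 for the last variable, as the constant term in that variable *)

Definition drop_last_var (K : comNzRingType) k (p : mpoly.mpoly k.+1 K) :
  mpoly.mpoly k K := (mpoly.muni p)`_0.

Section DropLastVar.
Variables (K : comNzRingType) (k : nat).
Implicit Type p : mpoly.mpoly k.+1 K.

Lemma drop_last_var_is_monoid_morphism :
  monoid_morphism (@drop_last_var K k).
Proof.
split=> [|p q]; first by rewrite /drop_last_var rmorph1 coef1.
by rewrite /drop_last_var rmorphM coef0M.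
Qed.

Lemma drop_last_var_is_zmod_morphism : zmod_morphism (@drop_last_var K k).
Proof. by move=> p q; rewrite /drop_last_var raddfB coefB. Qed.

HB.instance Definition _ := GRing.isZmodMorphism.Build _ _
  (@drop_last_var K k) drop_last_var_is_zmod_morphism.
HB.instance Definition _ := GRing.isMonoidMorphism.Build _ _
  (@drop_last_var K k) drop_last_var_is_monoid_morphism.

Lemma drop_last_varC (c : K) :
  drop_last_var (mpoly.mpolyC k.+1 c) = mpoly.mpolyC k c.
Proof. by rewrite /drop_last_var mpoly.muniC coefC. Qed.

Lemma drop_last_varX (m : mpoly.multinom k.+1) :
  drop_last_var (mpoly.mpolyX K m) =
  if m ord_max == 0%N then
    mpoly.mpolyX K (mpoly.Multinom [tuple m (widen_ord (leqnSn k) i) | i < k])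
  else 0.
Proof.
rewrite /drop_last_var mpoly.muniE mpoly.msuppX big_seq1 mpoly.mcoeffX eqxx.
rewrite scale1r coefZ coefXn eq_sym.
by case: eqP => _; rewrite ?mulr1 ?mulr0.
Qed.

(** [mnmwiden] appends the exponent 0, so the only monomial of [p] that contributes to either side
    is [mnmwiden m]. *)
Lemma mcoeff_drop_last_var p (m : mpoly.multinom k) :
  mpoly.mcoeff m (drop_last_var p) = mpoly.mcoeff (mpoly.mnmwiden m) p.
Proof.
rewrite [in LHS](mpoly.mpolyE p) [in RHS](mpoly.mpolyE p) !raddf_sum/=.
apply: eq_bigr => m1 _.
rewrite -mpoly.mul_mpolyC rmorphM/= drop_last_varC drop_last_varX.
rewrite !mpoly.mcoeffCM mpoly.mcoeffX; congr (_ * _).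
have [->|neq] := eqVneq m1 (mpoly.mnmwiden m).
  rewrite mpoly.mnmwiden_ordmax eqxx mpoly.mcoeffX; congr (_%:R).
  apply/eqP; rewrite eqb1; apply/eqP/mpoly.mnmP => i.
  by rewrite mpoly.multinomE tnth_mktuple mpoly.mnmwiden_widen.
case: ifPn => [/eqP m10|_]; last by rewrite mpoly.mcoeff0.
rewrite mpoly.mcoeffX; case: eqP => // m1E; case/eqP: neq.
apply/mpoly.mnmP => i; rewrite -m1E.
case: (unliftP ord_max i) => [j|] ->; last by rewrite mpoly.mnmwiden_ordmax.
have -> : lift ord_max j = widen_ord (leqnSn k) j.
  by apply: val_inj; rewrite /= /bump leqNgt ltn_ord.
by rewrite mpoly.mnmwiden_widen mpoly.multinomE tnth_mktuple.
Qed.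

(** A ring morphism commutes with [\det], and this one kills the last summand of the pencil. *)
Lemma drop_last_var_det_pencil n (Y : nat -> 'M[K]_n) :
  drop_last_var (det_pencil (fun i : 'I_k.+1 => Y i)) =
  det_pencil (fun i : 'I_k => Y i).
Proof.
rewrite /det_pencil -det_map_mx; congr (\det _); apply/matrixP => p q.
rewrite !mxE rmorphD/= rmorph_nat; congr (_ + _).
rewrite !summxE rmorph_sum big_ord_recr/= [X in _ + X](_ : _ = 0) ?addr0.
  apply: eq_bigr => i _; rewrite !mxE rmorphM/= drop_last_varC drop_last_varX.
  rewrite mpoly.mnm1E -val_eqE/= (ltn_eqF (ltn_ord i))/=.
  congr (mpoly.mpolyX _ _ * _).
  apply/mpoly.mnmP => j; rewrite mpoly.multinomE tnth_mktuple !mpoly.mnm1E.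
  by rewrite -!val_eqE.
by rewrite !mxE rmorphM/= drop_last_varX mpoly.mnm1E eqxx/= mul0r.
Qed.
End DropLastVar.

(** * Independence of the number of indices *)

Section Truncation.
Variables (K : comNzRingType) (n : nat).
Implicit Types (m : nat -> int) (Y : nat -> 'M[K]_n).

(** The number of indices is explicit here, whereas [Zseq] takes it from the choice made in
    [index_bound]. *)
Definition Ztrunc k m Y : K :=
  Zinv (fun i : 'I_k => m i) (fun i : 'I_k => Y i).

Lemma Ztrunc_neg k m Y i : (i < k)%N -> m i < 0 -> Ztrunc k m Y = 0.
Proof.
move=> ik mi; rewrite /Ztrunc /Zinv; case: forallP => // /(_ (Ordinal ik)) /=.
by rewrite leNgt mi.
Qed.

(** The coefficient of a monomial free of the last variable survives setting that variable to 0. *)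
Lemma Ztrunc_S k m Y : m k = 0 -> Ztrunc k.+1 m Y = Ztrunc k m Y.
Proof.
move=> mk; rewrite /Ztrunc /Zinv.
have -> : [forall i : 'I_k.+1, 0 <= m i] = [forall i : 'I_k, 0 <= m i].
  apply/forallP/forallP => /= H i.
    exact: (H (widen_ord (leqnSn k) i)).
  have := ltn_ord i; rewrite ltnS leq_eqVlt => /predU1P[->|ik].
    by rewrite mk.
  exact: (H (Ordinal ik)).
case: ifP => // _.
rewrite -(drop_last_var_det_pencil k Y) mcoeff_drop_last_var.
congr (mpoly.mcoeff _ _); apply/mpoly.mnmP => i.
rewrite mpoly.multinomE tnth_mktuple.
have := ltn_ord i; rewrite ltnS leq_eqVlt => /predU1P[ik|ik].
  have -> : i = ord_max by exact: val_inj.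
  by rewrite mpoly.mnmwiden_ordmax /= mk.
have -> : i = widen_ord (leqnSn k) (Ordinal ik) by exact: val_inj.
by rewrite mpoly.mnmwiden_widen mpoly.multinomE tnth_mktuple.
Qed.

Lemma Ztrunc_stable b k m Y : (forall i, (b <= i)%N -> m i = 0) ->
  (b <= k)%N -> Ztrunc k m Y = Ztrunc b m Y.
Proof.
move=> m0; elim: k => [|k IH]; first by rewrite leqn0 => /eqP ->.
by rewrite leq_eqVlt => /predU1P[->//|bk]; rewrite Ztrunc_S ?IH ?m0.
Qed.

Lemma ZseqE k m Y : (forall i, (k <= i)%N -> m i = 0) ->
  Zseq m Y = Ztrunc k m Y.
Proof.
move=> m0.
have bP : [set M | forall i, (M < i)%N -> m i = 0] (index_bound m).
  by apply: (@xgetPex _ 0%N); exists k => /= i /ltnW; exact: m0.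
rewrite /Zseq -/(Ztrunc _ _ _).
(* The chosen bound and [k] are both compared with their maximum. *)
rewrite -(Ztrunc_stable _ m0 (leq_maxr (index_bound m).+1 k)).
by rewrite (Ztrunc_stable _ bP (leq_maxl _ _)).
Qed.

End Truncation.

(** * The pencil under the two derivations *)

Definition pencil (K : comNzRingType) n k (X : 'I_k -> 'M[K]_n) :
    'M[mpoly.mpoly k K]_n :=
  1%:M + \sum_(i < k)
    mpoly.mpolyX K (mpoly.mnm1 i) *: map_mx (@mpoly.mpolyC k K) (X i).

(** The derivative of the pencil when each [X i] has derivative [X i.+1]. The family is indexed by
    [nat] because [X k] occurs, outside the range [i < k]. *)
Definition pencil_deriv (K : comNzRingType) n k (X : nat -> 'M[K]_n) :
    'M[mpoly.mpoly k K]_n :=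
  \sum_(i < k)
    mpoly.mpolyX K (mpoly.mnm1 i) *: map_mx (@mpoly.mpolyC k K) (X i.+1).

Section PencilDerivative.
Variables (K : comNzRingType) (n : nat).

Lemma coeffwise_pencil (T : Type) (t : T) (D : (T -> K) -> K -> Prop) k
    (Y : nat -> T -> 'M[K]_n) : derivation_at t D ->
    (forall j p q, D (fun s => Y j s p q) (Y j.+1 t p q)) ->
  forall p q, coeffwise D (fun s => pencil (fun i : 'I_k => Y i s) p q)
    (pencil_deriv k (fun j => Y j t) p q).
Proof.
move=> derD DY p q; have derC := coeffwise_derivation k derD.
under eq_fun do rewrite !mxE summxE.
rewrite -[pencil_deriv _ _ _ _]add0r; apply: (derivation_atD derC).
  exact: derivation_at_nat derC _.
rewrite summxE; apply: (derivation_at_sum derC) => i _.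
under eq_fun do rewrite !mxE.
rewrite !mxE; apply: (derivation_atMl derC) => m.
  rewrite mpoly.mcoeff0; under eq_fun do rewrite mpoly.mcoeffX.
  exact: derivation_at_nat derD _.
rewrite mpoly.mcoeffC mulrC; under eq_fun do rewrite mpoly.mcoeffC mulrC.
by apply: (derivation_atMl derD) => //; exact: derivation_at_nat derD _.
Qed.

Lemma mderiv_pencil k (X : 'I_k -> 'M[K]_n) j p q :
  mpoly.mderiv j (pencil X p q) = mpoly.mpolyC k (X j p q).
Proof.
rewrite !mxE summxE mpoly.mderivD -mpoly.mpolyC_nat mpoly.mderivC add0r.
rewrite raddf_sum/= (bigD1 j)//= big1 ?addr0 => [|i ij]; rewrite !mxE.
  rewrite mpoly.mderivM mpoly.mderivC mulr0 addr0 mpoly.mderivX mpoly.mnm1E eqxx.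
  by rewrite scale1r -[X in mpoly.mnm_sub X]mpoly.add0m mpoly.addmK mpoly.mpolyX0 mul1r.
rewrite mpoly.mderivM mpoly.mderivC mulr0 addr0 mpoly.mderivX mpoly.mnm1E.
by rewrite (negbTE ij) scale0r mul0r.
Qed.

(** [lowering] turns [a_(i+1) X_(i+1)] into [a_i X_(i+1)]. This yields every term except the one
    with [X k.+1], whose variable [a_(k+1)] is cut off. *)
Lemma pencil_derivE k (X : nat -> 'M[K]_n) :
  pencil_deriv k.+1 X =
  map_mx (@lowering K k) (pencil (fun i : 'I_k.+1 => X i)) +
  mpoly.mpolyX K (mpoly.mnm1 ord_max) *:
    map_mx (@mpoly.mpolyC k.+1 K) (X k.+1).
Proof.
rewrite /pencil_deriv big_ord_recr/=; congr (_ + _).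
apply/matrixP => p q; rewrite summxE mxE; apply: eq_bigr => i _.
by rewrite mderiv_pencil !mxE.
Qed.

(** A general [D] covers real and complex entries at once. The condition [m k = 0] discards the
    extra term of [pencil_derivE]. *)
Lemma derivation_at_Ztrunc (T : Type) (t : T) (D : (T -> K) -> K -> Prop) k
    (Y : nat -> T -> 'M[K]_n) (m : nat -> int) : derivation_at t D ->
    (forall j p q, D (fun s => Y j s p q) (Y j.+1 t p q)) -> m k = 0 ->
  D (fun s => Ztrunc k.+1 m (fun j => Y j s))
    (\sum_(i < k) (m i.+1 + 1)%:~R *
       Ztrunc k.+1 (shift_index i.+1 m) (fun j => Y j t)).
Proof.
move=> derD DY mk.
have [/forallP m_ge0|/forallPn[/= j]] :=
    boolP [forall i : 'I_k.+1, 0 <= m i]; last first.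
  rewrite -ltNge => mj.
  under eq_fun do rewrite (Ztrunc_neg _ (ltn_ord j) mj).
  rewrite big1 => [|i _]; first exact: derivation_at0 derD.
  (* Raising [m i.+1] can remove a negative index only if it is -1, and then the factor [m i.+1 + 1]
     vanishes. *)
  have [mi|mi] := eqVneq (m i.+1) (-1); first by rewrite mi addNr mul0r.
  rewrite (Ztrunc_neg _ (ltn_ord j)) ?mulr0// /shift_index/=.
  case: eqP => [_|_]; first by rewrite (lt_trans _ mj)// ltrBlDr ltrDl.
  case: eqP => // ji; rewrite ji in mj *.
  by move: mj mi; case: (m i.+1) => [//|[|l]].
under eq_fun do rewrite /Ztrunc /Zinv (introT forallP m_ge0).
have := derivation_at_det (coeffwise_derivation k.+1 derD)
  (coeffwise_pencil derD DY) (multinom_abs (fun i : 'I_k.+1 => m i)).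
congr (D _ _); set P := pencil _.
(* The extra term is a multiple of the last variable, which has exponent [m k = 0] in the
   monomial. *)
rewrite pencil_derivE -/P det_derivD det_derivZ mpoly.mcoeffD [X in _ + X]mcoeffXM.
rewrite mpoly.multinomE tnth_mktuple/= mk eqxx addr0.
(* Since [lowering] is a derivation too, what remains is [lowering (\det P)]. *)
have -> := derivation_at_det (lowering_derivation K k) (M := fun=> P)
  (M' := map_mx (@lowering K k) P) (fun p q => mxE _ _ _ _).
rewrite raddf_sum; apply: eq_bigr => i _ /=.
rewrite mcoeffXM mpoly.multinomE tnth_mktuple/=.
have mi_ge0 := m_ge0 (widen_ord (leqnSn k) i); rewrite /= in mi_ge0.
have mi1_ge0 := m_ge0 (lift ord0 i); rewrite lift0 in mi1_ge0.
case: eqP => [/eqP|/eqP mi0].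
  rewrite absz_eq0 => /eqP mi0.
  have neg : shift_index i.+1 m i < 0 by rewrite /shift_index/= eqxx mi0.
  by rewrite (Ztrunc_neg _ (leqW (ltn_ord i)) neg) mulr0.
(* Now [m i > 0]. Multiplication by [a_i] has lowered its exponent; differentiation by [a_(i+1)]
   raises that exponent and brings out the factor [m i.+1 + 1]. *)
rewrite mpoly.mcoeff_deriv /Ztrunc /Zinv ifT.
  rewrite -mulr_natl; apply: (congr2 *%R).
    rewrite pmulrn; congr (_%:~R).
    rewrite mpoly.mnmBE mpoly.multinomE tnth_mktuple mpoly.mnm1E lift0.
    rewrite -val_eqE/= /bump leq0n add1n (ltn_eqF (ltnSn i)) subn0 -addn1 PoszD.
    by rewrite gez0_abs.
  apply: (congr1 (fun u => mpoly.mcoeff u (\det P))).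
  apply/mpoly.mnmP => l; rewrite mpoly.mnmDE mpoly.mnmBE !mpoly.mnm1E.
  rewrite !mpoly.multinomE !tnth_mktuple /shift_index -!val_eqE/= /bump leq0n add1n.
  have ml_ge0 := m_ge0 l.
  rewrite [_ == i :> nat]eq_sym [_ == i.+1 :> nat]eq_sym.
  case: eqP => [il|_]; last by case: eqP => _; lia.
  rewrite -il in ml_ge0 mi0 *.
  by rewrite (gtn_eqF (ltnSn i)); lia.
apply/forallP => l; have ml_ge0 := m_ge0 l; rewrite /shift_index/=.
case: eqP => [li|_]; last by case: eqP => _; lia.
by move: mi0 ml_ge0; rewrite li; lia.
Qed.
End PencilDerivative.

(** * The derivative in a real variable as a derivation, for real and complex values *)

Lemma is_derive_derivation_at (R : realType) (t : R) :
  derivation_at t (fun (f : R -> R) (a : R) => is_derive t (1 : R) f a).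
Proof.
split=> [|f g f' g' Df Dg|f g f' g' Df Dg].
- exact: is_derive_cst.
- exact: is_deriveB.
- rewrite addrC mulrC [_ * g t]mulrC [g' * _]mulrC.
  exact: is_deriveM.
Qed.

Section RcomplexDerive.
Variable R : realType.
Local Notation C := (Rcomplex R).

Lemma Rcomplex_normM (x y : C) : `|(x * y : C)| = `|x| * `|y| :> R.
Proof. exact: Normc.normcM. Qed.

Lemma Rcomplex_scaleAl (a : R) (x y : C) : a *: (x * y : C) = a *: x * y :> C.
Proof. exact: scalerAl. Qed.

Lemma Rcomplex_scaleAr (a : R) (x y : C) : a *: (x * y : C) = x * (a *: y) :> C.
Proof. by rewrite mulrC Rcomplex_scaleAl mulrC. Qed.

(** The modulus is multiplicative, so [|f g - a b|] is at most [|f - a| |g| + |a| |g - b|], which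
    tends to 0. *)
Lemma Rcomplex_cvgM (T : Type) (F : set_system T) (FF : Filter F)
    (f g : T -> C) (a b : C) :
  f @ F --> a -> g @ F --> b -> (fun x => f x * g x : C) @ F --> (a * b : C).
Proof.
move=> fa gb.
have fa0 : `|f x - a| @[x --> F] --> (0 : R).
  exact/norm_cvg0P/subr_cvg0.
have gb0 : `|g x - b| @[x --> F] --> (0 : R).
  exact/norm_cvg0P/subr_cvg0.
have ng : `|g x| @[x --> F] --> `|b| by exact: cvg_norm.
apply/subr_cvg0/norm_cvg0P.
apply: (@squeeze_cvgr _ _ _ _ (fun=> 0)
    (fun x => `|f x - a| * `|g x| + `|a| * `|g x - b|)).
- near=> x; rewrite normr_ge0/= -!Rcomplex_normM.
  apply: le_trans (ler_normD _ _).
  by rewrite mulrBl mulrBr addrA subrK.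
- exact: cvg_cst.
- rewrite -[X in _ --> X](_ : 0 * `|b| + `|a| * 0 = 0); last first.
    by rewrite mul0r mulr0 addr0.
  by apply: cvgD; apply: cvgM => //; exact: cvg_cst.
Unshelve. all: by end_near.
Qed.

Lemma Rcomplex_derivation_at (t : R) :
  derivation_at t (fun (f : R -> C) (a : C) => is_derive t (1 : R) f a).
Proof.
split=> [|f g f' g' Df Dg|f g f' g' Df Dg].
- exact: is_derive_cst.
- exact: is_deriveB.
suff H : (fun h : R => h^-1 *: (((fun s => f s * g s : C) \o shift t) (h *: (1 : R))
      - f t * g t) : C) @ 0^' --> (f' * g t + f t * g' : C).
  apply: DeriveDef; last exact: cvg_lim H.
  by apply/cvg_ex; exists (f' * g t + f t * g').
have cf : (fun h : R => h^-1 *: ((f \o shift t) (h *: (1 : R)) - f t)) @ 0^'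
    --> f'.
  by case: Df => Df <-.
have cg : (fun h : R => h^-1 *: ((g \o shift t) (h *: (1 : R)) - g t)) @ 0^'
    --> g'.
  by case: Dg => Dg <-.
have ct : (fun h : R => g (h *: (1 : R) + t)) @ 0^' --> g t.
  suff : {for 0, continuous (fun h : R => g (h *: (1 : R) + t))}.
    by move=> /continuous_withinNx; rewrite scale0r add0r.
  have /derivable1P/derivable1_diffP := @ex_derive _ _ _ _ _ _ _ Dg.
  exact: differentiable_continuous.
(* The difference quotient of the product is that of [f] times [g (h + t)], plus [f t] times that of
   [g]; continuity of [g] at [t] gives the limit. *)
have c := cvgD (Rcomplex_cvgM _ cf ct) (Rcomplex_cvgM _ (cvg_cst (f t)) cg).
apply: cvg_trans (c _ _ _ _); apply: near_eq_cvg; near=> h; rewrite fctE/=.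
rewrite -Rcomplex_scaleAl -Rcomplex_scaleAr -scalerDr; congr (_ *: _).
by rewrite mulrBl mulrBr addrA subrK.
Unshelve. all: by end_near.
Qed.

End RcomplexDerive.

(** * From truncations to index sequences, and the infinite sum *)

Section Zseq.
Variables (K : comNzRingType) (n k : nat) (m : nat -> int).
Hypothesis m0 : forall i, (k <= i)%N -> m i = 0.

(** The shift changes positions [i] and [i.+1 <= k] only, so [k.+1] indices suffice. *)
Lemma Zseq_shift_index (Y : nat -> 'M[K]_n) i : (i < k)%N ->
  Zseq (shift_index i.+1 m) Y = Ztrunc k.+1 (shift_index i.+1 m) Y.
Proof.
move=> ik; apply: ZseqE => j kj; rewrite /shift_index/= !gtn_eqF ?m0//; lia.
Qed.

(** The zero index at position [i] is lowered to -1. *)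
Lemma Zseq_shift_index0 (Y : nat -> 'M[K]_n) i : (k <= i)%N ->
  Zseq (shift_index i.+1 m) Y = 0.
Proof.
move=> ki; rewrite (@ZseqE _ _ i.+2) => [|j ij].
  by apply: (@Ztrunc_neg _ _ _ _ _ i); rewrite // /shift_index/= eqxx m0.
by rewrite /shift_index/= !gtn_eqF ?m0//; lia.
Qed.

Lemma finite_Zseq_shift_index (T : Type) (Y : nat -> T -> 'M[K]_n) :
  finite_set [set i | (1 <= i)%N /\
    exists t, Zseq (shift_index i m) (fun j => Y j t) != 0].
Proof.
apply: (sub_finite_set _ (finite_II k.+1)) => -[|i] [// _ [t]] /=.
by rewrite ltnS; apply: contraNT; rewrite -leqNgt => /Zseq_shift_index0 ->.
Qed.

Lemma derivation_at_Zseq (T : Type) (t : T) (D : (T -> K) -> K -> Prop)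
    (Y : nat -> T -> 'M[K]_n) : derivation_at t D ->
    (forall j p q, D (fun s => Y j s p q) (Y j.+1 t p q)) ->
  D (fun s => Zseq m (fun j => Y j s))
    (\sum_(i \in [set i | (1 <= i)%N])
       (m i + 1)%:~R * Zseq (shift_index i m) (fun j => Y j t)).
Proof.
move=> derD DY.
(* Only the terms with index from 1 to [k] can be nonzero. *)
rewrite (@fsbigE _ _ _ _ _ (iota 1 k)).
(* Taking [k.+1] indices makes the last one [m k], which is 0. *)
- under eq_fun do rewrite (ZseqE (k := k.+1) _ (fun i ki => m0 (ltnW ki))).
  have := derivation_at_Ztrunc derD DY (m0 (leqnn k)).
  congr (D _ _); rewrite -[iota _ _]/(iota (1 + 0) k) iotaDl big_map.
  rewrite -[in iota 0 k](subn0 k) -/(index_iota 0 k) big_mkord.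
  apply: eq_big => [i|i _]; first by apply/esym/mem_set.
  by rewrite Zseq_shift_index.
- exact: iota_uniq.
- by move=> i /=; rewrite mem_iota => /andP[].
- move=> [|i] //= _; rewrite mem_iota/= add1n ltnS -leqNgt => /Zseq_shift_index0 ->.
  by rewrite mulr0.
Qed.

End Zseq.

(** * Application to the successive derivatives of a smooth matrix function *)

Lemma is_derive_derive1n (R : realType) (V : normedModType R) (f : R -> V) j t :
  derivable (derive1n j f) t 1 ->
  is_derive t (1 : R) (derive1n j f) (derive1n j.+1 f t).
Proof. by rewrite derive1nS derive1E; exact: derivableP. Qed.

Theorem mainTheorem4 (R : realType) (n : nat) (hn : (1 <= n)%N)
    (m : nat -> int) (hm : exists M : nat, forall i, (M < i)%N -> m i = 0) :
  (forall X : R -> 'M[R]_n, mxsmooth X ->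
     finite_set [set i | (1 <= i)%N /\
                         exists t, Zjet (shift_index i m) X t != 0] /\
     forall t : R,
       is_derive t (1 : R) (Zjet m X)
         (\sum_(i \in [set i | (1 <= i)%N])
            (m i + 1)%:~R * Zjet (shift_index i m) X t)) /\
  (forall X : R -> 'M[Rcomplex R]_n, mxsmooth X ->
     finite_set [set i | (1 <= i)%N /\
                         exists t, Zjet (shift_index i m) X t != 0] /\
     forall t : R,
       is_derive t (1 : R) (Zjet m X)
         (\sum_(i \in [set i | (1 <= i)%N])
            (m i + 1)%:~R * Zjet (shift_index i m) X t)).
Proof.
(* [M < i] is [M.+1 <= i] by definition, so the results on [Zseq] apply with [k] equal to [M.+1]. *)
case: hm => M m0; split=> X smX; split=> [|t].
- exact: (finite_Zseq_shift_index m0 (fun j => mxderive1n j X)).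
- apply: (derivation_at_Zseq m0 (is_derive_derivation_at t)) => j p q.
  rewrite mxE; under eq_fun do rewrite mxE.
  exact: is_derive_derive1n.
- exact: (finite_Zseq_shift_index m0 (fun j => mxderive1n j X)).
- apply: (derivation_at_Zseq m0 (Rcomplex_derivation_at t)) => j p q.
  rewrite mxE; under eq_fun do rewrite mxE.
  exact: is_derive_derive1n.
Qed.
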